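(* The problem $d$-Coloring has extension complexity $d^{k}n^{O(1)}$ on $n$-vertex graphs of treewidth at most $k$. Under ETH, this problem has no extended formulation with $d^{o(k)}n^{O(1)}$ inequalities.
   Context: $d$-Coloring is the problem consisting of all pairs $(G,(X_1,\dots,X_d))$ where $G$ is a graph and $(X_1,\dots,X_d)$ is a partition of $V_G$ into independent sets. A solution $X=(X_1,\dots,X_d)$ is encoded as the 0/1 matrix $\hat X$ with $d$ rows and $|V_G|$ columns where $\hat X_{iv}=1$ iff $v\in X_i$; the solution polytope $P_{\Pi}(G)$ is the convex hull of all such matrices for solutions in $G$. A problem $\Pi$ has extension complexity $f(k,n)$ on $n$-vertex graphs of treewidth at most $k$ if for each such graph $G$, $P_{\Pi}(G)$ has extension complexity at most $f(k,n)$. $\Pi$ has no extended formulation with $g(k,n)$ inequalities if no polytope $P'$ that is an extended formulation of $P_{\Pi}(G)$ can be defined with $g(k,n)$ inequalities or fewer.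
   Formalization: The lower bound is stated for d ≥ 3 only, since for d = 1, 2 the polytope is empty, a point or an affine image of a cube and O(n) inequalities always suffice; the upper bound is stated for d ≥ 1, with d fixed, so the constants in n^{O(1)} may depend on d. *)

(* Defs.v *)
From HB Require Import structures.
From mathcomp Require Import all_boot all_order all_algebra.
From mathcomp Require Import all_classical all_reals all_analysis.
Set Implicit Arguments.
Unset Strict Implicit.
Unset Printing Implicit Defensive.
Import Order.TTheory GRing.Theory Num.Theory.
Import numFieldNormedType.Exports.
Local Open Scope classical_set_scope.
Local Open Scope ring_scope.

Record sgraph (V : finType) := SGraph {
  adj :> rel V;
  adj_sym : symmetric adj;
  adj_irr : irreflexive adj }.

Definition is_tree (T : finType) (t : sgraph T) : Prop :=
  [/\ (0 < #|T|)%N,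
      forall i j : T, connect t i j &
      forall p : seq T, ucycle t p -> (size p < 3)%N].

Record tree_decomposition (V T : finType) (G : sgraph V) (t : sgraph T)
    (B : T -> {set V}) : Prop := TreeDecomposition {
  td_tree : is_tree t;
  td_vertex : forall v : V, exists i : T, v \in B i;
  td_edge : forall u v : V, G u v -> exists i : T, (u \in B i) && (v \in B i);
  td_subtree : forall (v : V) (i j : T), v \in B i -> v \in B j ->
    connect [rel x y | [&& t x y, v \in B x & v \in B y]] i j }.

(* The width of a decomposition is the maximal bag size minus one. *)
Definition treewidth_le (V : finType) (G : sgraph V) (k : nat) : Prop :=
  exists (T : finType) (t : sgraph T) (B : T -> {set V}),
    tree_decomposition G t B /\ forall i : T, (#|B i| <= k.+1)%N.

Definition conv_hull (R : realType) (E : lmodType R) (S : set E) : set E :=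
  [set x | exists (N : nat) (p : 'I_N -> E) (a : 'I_N -> R),
     [/\ forall i, S (p i), forall i, 0 <= a i,
         \sum_(i < N) a i = 1 & x = \sum_(i < N) a i *: p i]].

(* Q is the solution set of a linear system with r inequalities; as usual for
   extended formulations, linear equations are allowed and not counted. *)
Definition defined_by_ineqs (R : realType) (m : nat) (Q : set 'cV[R]_m)
    (r : nat) : Prop :=
  exists (A : 'M[R]_(r, m)) (b : 'cV[R]_r)
         (q : nat) (C : 'M[R]_(q, m)) (e : 'cV[R]_q),
    Q = [set y | (forall i, (A *m y) i 0 <= b i 0) /\ C *m y = e].

Definition is_polytope (R : realType) (m : nat) (Q : set 'cV[R]_m) : Prop :=
  (exists r, defined_by_ineqs Q r) /\
  (exists M : R, forall y, Q y -> forall i, `|y i 0| <= M).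

Definition extended_formulation (R : realType) (E : lmodType R) (P : set E)
    (m : nat) (Q : set 'cV[R]_m) : Prop :=
  is_polytope Q /\ exists pi : {linear 'cV[R]_m -> E}, pi @` Q = P.

(* xc(P) <= x, where xc(P) is the minimum number of inequalities defining an
   extended formulation of P. *)
Definition ext_complexity_le (R : realType) (E : lmodType R) (P : set E)
    (x : R) : Prop :=
  exists (m : nat) (Q : set 'cV[R]_m) (r : nat),
    [/\ extended_formulation P Q, defined_by_ineqs Q r & r%:R <= x].

(* Problems whose solutions are d-tuples of vertex sets. *)
Definition vertex_problem (d : nat) : Type :=
  forall n : nat, sgraph 'I_n -> set {ffun 'I_d -> {set 'I_n}}.

Definition independent (V : finType) (G : sgraph V) (A : {set V}) : Prop :=
  forall u v, u \in A -> v \in A -> ~~ G u v.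

(* Colour classes may be empty. *)
Definition coloring (d : nat) : vertex_problem d := fun n G =>
  [set X : {ffun 'I_d -> {set 'I_n}} |
     [/\ forall v, exists i, v \in X i,
         forall i j, i != j -> [disjoint X i & X j]%B &
         forall i, independent G (X i)]].

Definition solution_mx (R : realType) (d n : nat)
    (X : {ffun 'I_d -> {set 'I_n}}) : 'M[R]_(d, n) :=
  \matrix_(i, v) (v \in X i)%:R.

Definition solution_polytope (R : realType) (d : nat) (Pi : vertex_problem d)
    (n : nat) (G : sgraph 'I_n) : set 'M[R]_(d, n) :=
  conv_hull (@solution_mx R d n @` Pi n G).
Arguments solution_polytope R {d} Pi {n} G.

Definition has_ext_complexity (R : realType) (d : nat) (Pi : vertex_problem d)
    (f : nat -> nat -> R) : Prop :=
  forall (k n : nat) (G : sgraph 'I_n), treewidth_le G k ->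
    ext_complexity_le (solution_polytope R Pi G) (f k n).

(* The bound g fails for some graph of treewidth at most k. *)
Definition no_ext_formulation (R : realType) (d : nat) (Pi : vertex_problem d)
    (g : nat -> nat -> R) : Prop :=
  exists (k n : nat) (G : sgraph 'I_n), treewidth_le G k /\
    forall (m : nat) (Q : set 'cV[R]_m),
      extended_formulation (solution_polytope R Pi G) Q ->
      forall r : nat, defined_by_ineqs Q r -> g k n < r%:R.

(* The class n^O(1). The factor C cannot be dropped: for n = 1 the d-colouring
   polytope is a simplex with d vertices. *)
Definition poly_bounded (R : realType) (p : nat -> R) : Prop :=
  exists C c : nat, forall n, p n <= C%:R * n%:R ^+ c.

Inductive move := MoveL | MoveR | Stay.

Record tm (A : finType) := TM {
  tm_state : finType;
  tm_work : finType;
  tm_start : tm_state;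
  tm_halt : tm_state -> option bool;  (* Some b: halt with answer b *)
  tm_delta : tm_state -> option (A + tm_work) ->
             tm_state * option (A + tm_work) * move }.

(* Tape cells contain an input symbol, a work symbol, or the blank None. *)
Definition cell (A : finType) (M : tm A) : Type := option (A + tm_work M).

(* The cells left of the head (nearest first), the scanned cell, and the cells
   right of it; the two-way infinite tape is blank beyond the stored cells. *)
Record config (A : finType) (M : tm A) := Config {
  c_state : tm_state M;
  c_left : seq (cell M);
  c_head : cell M;
  c_right : seq (cell M) }.

Definition tm_init (A : finType) (M : tm A) (w : seq A) : config M :=
  let s : seq (cell M) := [seq Some (inl a) | a <- w] in
  Config (tm_start M) [::] (head None s) (behead s).

Definition tm_step (A : finType) (M : tm A) (c : config M) : config M :=
  if tm_halt (c_state c) is Some _ then c else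
  let: (q, x, mv) := tm_delta (c_state c) (c_head c) in
  match mv with
  | MoveL => Config q (behead (c_left c)) (head None (c_left c))
                    (x :: c_right c)
  | MoveR => Config q (x :: c_left c) (head None (c_right c))
                    (behead (c_right c))
  | Stay => Config q (c_left c) x (c_right c)
  end.

Definition tm_answer (A : finType) (M : tm A) (w : seq A) (t : nat) :
    option bool :=
  tm_halt (c_state (iter t (@tm_step A M) (tm_init M w))).

(* The literal (b, i) is the variable x_i if b and its negation otherwise. *)
Definition literal : Type := (bool * nat)%type.
Definition clause : Type := seq literal.
Definition cnf : Type := seq clause.

Definition is_3cnf (phi : cnf) : bool := all (fun c => size c <= 3)%N phi.

Definition satisfiable (phi : cnf) : Prop :=
  exists a : nat -> bool, all (has (fun l : literal => a l.2 == l.1)) phi.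

Definition nvars (phi : cnf) : nat :=
  size (undup [seq l.2 | l : literal <- flatten phi]).

(* Words over option bool: a literal (b, i) is written as its sign Some b
   followed by i blocks [None; Some true], that is, with its index in unary;
   a clause is terminated by [None; Some false]. *)
Definition encode_literal (l : literal) : seq (option bool) :=
  Some l.1 :: flatten (nseq l.2 [:: None; Some true]).
Definition encode (phi : cnf) : seq (option bool) :=
  flatten [seq flatten (map encode_literal c) ++ [:: None; Some false]
          | c : clause <- phi].

(* M decides 3-SAT in time O*(2 ^ (delta n)), n the number of variables. *)
Definition solves_3sat_in (R : realType) (M : tm (option bool)) (delta : R) :
    Prop :=
  exists C c : nat, forall phi : cnf, is_3cnf phi ->
    exists (t : nat) (b : bool),
      [/\ t%:R <= C%:R * 2 `^ (delta * (nvars phi)%:R)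
                  * (size (encode phi)).+1%:R ^+ c,
          tm_answer M (encode phi) t = Some b &
          b <-> satisfiable phi].

(* Exponential Time Hypothesis (Impagliazzo-Paturi): the infimum of all delta
   for which 3-SAT is solvable in time O*(2 ^ (delta n)) is positive. *)
Definition ETH (R : realType) : Prop :=
  exists delta : R, 0 < delta /\
    ~ exists M : tm (option bool), solves_3sat_in M delta.

(* Main.v *)
Require Import Defs.
From HB Require Import structures.
From mathcomp Require Import all_boot all_order all_algebra.
From mathcomp Require Import all_classical all_reals all_analysis.
From mathcomp Require Import zify ring lra.
Set Implicit Arguments.
Unset Strict Implicit.
Unset Printing Implicit Defensive.
Import Order.TTheory GRing.Theory Num.Theory.
Import numFieldNormedType.Exports.
Import mathcomp.boot.fintype mathcomp.boot.finset.
Local Open Scope classical_set_scope.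
Local Open Scope ring_scope.

(** Upper bound.  A decomposition of width k, rooted anywhere, gives an
    elimination order in which each vertex has a bag of at most k + 1 vertices,
    so there are at most n d^(k+1) pairs of a vertex and a coloring of its bag.
    The formulation is the set of nonnegative vectors indexed by these pairs in
    the affine hull of the indicator vectors of the proper colorings.  Following
    the order, one finds greedily a proper coloring on all of whose bag
    restrictions a given point is positive; subtracting multiples of such
    colorings exhausts the point, which is thus a convex combination of them.

    Lower bound.  A graph on m + 2 m^2 vertices, of treewidth at most m + 1, has
    colorings x_b and valid inequalities L_a >= 0 indexed by the subsets of [m]
    with L_a(x_b) = (1 - |a :&: b|)^2, as in the correlation polytope.  The
    inequalities of an extended formulation cover the disjoint pairs (a, b) by
    rectangles free of pairs with |a :&: b| = 1; each contains at most 2^m of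
    the 3^m disjoint pairs (Kaibel and Weltge), and (3/2)^m is not
    d^(o(m)) m^(O(1)). *)

(** * Rectangles in the disjointness matrix *)

Lemma finset_ind (T : finType) (P : {set T} -> Prop) :
  P set0 ->
  (forall (x : T) (S : {set T}), x \notin S -> P S -> P (x |: S)%SET) ->
  forall S, P S.
Proof.
move=> P0 PU S; elim: {S}#|S| {-2}S (erefl #|S|) => [|n IHn] S cardS.
  by rewrite (cards0_eq cardS).
have /card_gt0P[x xS] : (0 < #|S|)%N by rewrite cardS.
rewrite -(setD1K xS); apply: PU; first by rewrite !inE eqxx.
by apply: IHn; move: cardS; rewrite (cardsD1 x) xS => -[].
Qed.

Lemma big_subsetU1 (R : Type) (idx : R) (op : Monoid.com_law idx)
    (T : finType) (x : T) (S : {set T}) (F : {set T} -> R) : x \notin S ->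
  \big[op/idx]_(a : {set T} | a \subset (x |: S)%SET) F a =
  \big[op/idx]_(a : {set T} | a \subset S) op (F a) (F (x |: a)%SET).
Proof.
move=> xS; rewrite big_split [LHS](bigID (fun a : {set T} => x \in a)) /=.
rewrite Monoid.mulmC; congr (op _ _).
  by apply: eq_bigl => a; rewrite -subsetD1 setU1K.
rewrite (reindex_onto (fun a => x |: a)%SET (fun a => a :\ x)%SET) =>
  [|a /andP[_ xa]].
  apply: eq_bigl => a; rewrite setU11 andbT subUset sub1set setU11 /=.
  apply/andP/idP => [[aS /eqP xa]|aS].
    by rewrite -[S](setU1K xS) subsetD1 aS -xa !inE eqxx.
  rewrite (subset_trans aS) ?subsetUr // setU1K ?eqxx //.
  by apply: contra xS; apply: subsetP.
exact: setD1K.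
Qed.

Section DisjointPairs.
Variable T : finType.
Implicit Types (S a b : {set T}) (F : {set T} -> {set T} -> nat).

Definition sum_disjoint_pairs S F : nat :=
  \sum_(a : {set T} | a \subset S) \sum_(b : {set T} | b \subset S :\: a) F a b.

Lemma sum_disjoint_pairsU1 x S F : x \notin S ->
  sum_disjoint_pairs (x |: S)%SET F =
  sum_disjoint_pairs S
    (fun a b => F a b + F a (x |: b)%SET + F (x |: a)%SET b)%N.
Proof.
move=> xS; rewrite /sum_disjoint_pairs big_subsetU1 //; apply: eq_bigr => a aS.
have xa : x \notin a by apply: contra xS; apply: subsetP.
have -> : ((x |: S) :\: a = x |: (S :\: a))%SET.
  by apply/setP => y; rewrite !inE; case: eqP => // ->; rewrite xa.
have -> : ((x |: S) :\: (x |: a) = S :\: a)%SET.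
  apply/setP => y; rewrite !inE; case: eqP => //= ->.
  by rewrite (negbTE xS) andbF.
by rewrite big_subsetU1 ?inE ?negb_and ?xS ?orbT // -big_split.
Qed.

Lemma sum_disjoint_pairs1 S :
  sum_disjoint_pairs S (fun _ _ => 1%N) = (3 ^ #|S|)%N.
Proof.
elim/finset_ind: S => [|x S xS IHS].
  rewrite /sum_disjoint_pairs (big_pred1 set0) => [|a]; last exact: subset0.
  by rewrite set0D (big_pred1 set0) ?cards0 // => b; apply: subset0.
rewrite sum_disjoint_pairsU1 // cardsU1 xS expnS -IHS [RHS]big_distrr.
by apply: eq_bigr => a _; rewrite big_distrr; apply: eq_bigr.
Qed.

(* The Kaibel-Weltge bound.  Disjoint a and b in S give the three disjoint pairs
   (a, b), (a, x |: b), (x |: a, b) in x |: S.  The rectangle cannot contain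
   both x |: a and x |: b, so the three are dominated by the rectangle whose
   rows a have a or x |: a in A, plus the one whose columns b have b or x |: b
   in B. *)
Lemma leq_disjoint_pairs_rectangle S (A B : pred {set T}) :
  (forall a b, a \subset S -> b \subset S -> A a -> B b -> #|a :&: b| != 1%N) ->
  (sum_disjoint_pairs S (fun a b => A a && B b) <= 2 ^ #|S|)%N.
Proof.
elim/finset_ind: S A B => [|x S xS IHS] A B AB1.
  rewrite /sum_disjoint_pairs (big_pred1 set0) => [|a]; last exact: subset0.
  rewrite set0D (big_pred1 set0) => [|b]; last exact: subset0.
  by rewrite cards0 leq_b1.
have SU a : a \subset S -> (a \subset x |: S)%SET.
  by move=> aS; rewrite (subset_trans aS) ?subsetUr.
have USU a : a \subset S -> (x |: a \subset x |: S)%SET.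
  exact: setUS.
have capUl a b : b \subset S -> ((x |: a) :&: b = a :&: b)%SET.
  move=> /subsetP/(_ x)/contra/(_ xS)/negbTE xb.
  by apply/setP => y; rewrite !inE; case: eqP => // ->; rewrite xb !andbF.
pose Ax a := A a || A (x |: a)%SET; pose Bx b := B b || B (x |: b)%SET.
have leAx : (sum_disjoint_pairs S (fun a b => Ax a && B b) <= 2 ^ #|S|)%N.
  apply: IHS => a b aS bS /orP[Aa|Aa] Bb; first by apply: AB1; rewrite ?SU.
  by rewrite -(capUl a) //; apply: AB1 => //; [apply: USU | apply: SU].
have leBx : (sum_disjoint_pairs S (fun a b => A a && Bx b) <= 2 ^ #|S|)%N.
  apply: IHS => a b aS bS Aa /orP[Bb|Bb]; first by apply: AB1; rewrite ?SU.
  rewrite setIC -(capUl b) // setIC.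
  by apply: AB1 => //; [apply: SU | apply: USU].
rewrite sum_disjoint_pairsU1 // cardsU1 xS expnS mul2n -addnn.
apply: leq_trans (leq_add leAx leBx).
rewrite -big_split; apply: leq_sum => a aS.
rewrite -big_split; apply: leq_sum => b /=; rewrite subsetD => /andP[bS ba].
have : ~~ (A (x |: a)%SET && B (x |: b)%SET).
  apply/negP => /andP[Aa Bb]; have := AB1 _ _ (USU _ aS) (USU _ bS) Aa Bb.
  rewrite -setUIr.
  have -> : (a :&: b)%SET = set0 by apply/eqP; rewrite setI_eq0 disjoint_sym.
  by rewrite setU0 cards1.
by rewrite /Ax /Bx; case: (A a); case: (A _); case: (B b); case: (B _).
Qed.

Lemma leq_disjointness_cover (I : finType) (A B : I -> pred {set T}) :
  (forall i a b, A i a -> B i b -> #|a :&: b| != 1%N) ->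
  (forall a b, a :&: b = set0 -> exists i, A i a && B i b) ->
  (3 ^ #|T| <= #|I| * 2 ^ #|T|)%N.
Proof.
move=> AB1 cov; rewrite -cardsT -sum_disjoint_pairs1 -sum_nat_const.
apply: (@leq_trans (\sum_(i : I)
    sum_disjoint_pairs [set: T]%SET (fun a b => A i a && B i b))%N).
  rewrite exchange_big; apply: leq_sum => a _ /=.
  rewrite exchange_big; apply: leq_sum => b; rewrite subsetD => /andP[_ ab].
  have [|i Aab] := cov a b; first by apply/eqP; rewrite setI_eq0 disjoint_sym.
  by rewrite (bigD1 i) //= Aab.
apply: leq_sum => i _.
by apply: leq_disjoint_pairs_rectangle => a b _ _; apply: AB1.
Qed.

End DisjointPairs.

(** * Slack matrices of extended formulations *)

Lemma ex_positive_step (R : realFieldType) (I : finType) (P : pred I)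
    (x D : I -> R) :
  (forall i, P i -> 0 < x i) ->
  exists2 t : R, 0 < t & forall i, P i -> t * D i <= x i.
Proof.
move=> x0; have D0 i : 0 < `|D i| + 1 by rewrite ltr_wpDl.
exists (\big[Num.min/1]_(i | P i) (x i / (`|D i| + 1))).
  by apply: lt_bigmin => // i Pi; rewrite divr_gt0 // x0.
move=> i Pi; set t := \big[_/_]_(_ | _) _.
have t0 : 0 <= t by apply: le_bigmin => // j Pj; rewrite divr_ge0 // ltW // x0.
apply: le_trans (_ : t * (`|D i| + 1) <= _).
  by rewrite ler_wpM2l // (le_trans (ler_norm _)) // lerDl.
by rewrite -ler_pdivlMr //; apply: bigmin_le_cond.
Qed.

Section Polyhedron.
Variables (R : realFieldType) (m r q : nat).
Variables (A : 'M[R]_(r, m)) (b : 'cV[R]_r) (C : 'M[R]_(q, m)) (e : 'cV[R]_q).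

Definition polyhedron : set 'cV[R]_m :=
  [set y | (forall i, (A *m y) i 0 <= b i 0) /\ C *m y = e].

Let mulmx_line k (B : 'M[R]_(k, m)) t (y z : 'cV[R]_m) i :
  (B *m (y + t *: (z - y))) i 0 =
  (B *m y) i 0 + t * ((B *m z) i 0 - (B *m y) i 0).
Proof. by rewrite mulmxDr -scalemxAr mulmxBr !mxE. Qed.

Let eqs_line t (y z : 'cV[R]_m) :
  C *m y = e -> C *m z = e -> C *m (y + t *: (z - y)) = e.
Proof.
by move=> Cy Cz; rewrite mulmxDr -scalemxAr mulmxBr Cy Cz subrr scaler0 addr0.
Qed.

Lemma polyhedron_midpoint y z :
  polyhedron y -> polyhedron z -> polyhedron (y + 2^-1 *: (z - y)).
Proof.
move=> [Ay Cy] [Az Cz]; split=> [i|]; last exact: eqs_line.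
by rewrite mulmx_line; have := Ay i; have := Az i; lra.
Qed.

Lemma ex_strict_point (F : set 'cV[R]_m) (y0 : 'cV[R]_m) :
  F `<=` polyhedron -> F y0 ->
  (forall y z, F y -> F z -> F (y + 2^-1 *: (z - y))) ->
  exists2 z, F z & forall i, (exists2 y, F y & (A *m y) i 0 < b i 0) ->
    (A *m z) i 0 < b i 0.
Proof.
move=> FP Fy0 mid.
have [z Fz zlt] : exists2 z, F z & forall i, i \in enum 'I_r ->
    (exists2 y, F y & (A *m y) i 0 < b i 0) -> (A *m z) i 0 < b i 0.
  elim: (enum 'I_r) => [|i l [z Fz zlt]]; first by exists y0.
  have [[w Fw wi]|none] := pselect (exists2 y, F y & (A *m y) i 0 < b i 0);
    last first.
    by exists z => // j; rewrite inE => /predU1P[->//|]; apply: zlt.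
  exists (z + 2^-1 *: (w - z)) => [|j]; first exact: mid.
  rewrite inE mulmx_line => /predU1P[-> _|/zlt jl /jl].
    by have := (FP _ Fz).1 i; lra.
  by have := (FP _ Fw).1 j; lra.
by exists z => // i; apply: zlt; rewrite mem_enum.
Qed.

Definition tight (i : 'I_r) (y : 'cV[R]_m) : bool := (A *m y) i 0 == b i 0.

(* A face is cut out by the inequalities that are tight on it: from a point z
   of the face at which no other inequality is tight, one can move a little away
   from any point y satisfying the tight ones. *)
Lemma face_tight (c : R) (l : {linear 'cV[R]_m -> R^o}) (y0 : 'cV[R]_m) :
  (forall y, polyhedron y -> 0 <= c + l y) -> polyhedron y0 -> c + l y0 = 0 ->
  exists J : {set 'I_r}, forall y, polyhedron y ->
    (c + l y == 0) = [forall i in J, tight i y].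
Proof.
move=> valid Py0 sy0; pose F := [set y | polyhedron y /\ c + l y = 0].
have line t y z : c + l (y + t *: (z - y)) = c + l y + t * (l z - l y).
  by rewrite linearD linearZ linearB addrA.
have [z [Pz sz] zlt] : exists2 z, F z & forall i,
    (exists2 y, F y & (A *m y) i 0 < b i 0) -> (A *m z) i 0 < b i 0.
  apply: (@ex_strict_point F y0) => // [y []//|y z [Py sy] [Pz sz]].
  by split; [apply: polyhedron_midpoint | rewrite line; lra].
pose J := [set i : 'I_r | tight i z]%SET.
have tightF i y : i \in J -> F y -> tight i y.
  rewrite inE => /eqP iz Fy; rewrite /tight eq_le Fy.1.1 /= leNgt.
  apply/negP => lt_y; have := zlt i (ex_intro2 _ _ y Fy lt_y).
  by rewrite iz ltxx.
exists J => y Py.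
apply/eqP/forall_inP => [sy i iJ|tight_y]; first exact: tightF.
have [|t t0 tP] := @ex_positive_step R 'I_r (fun i => i \notin J)
    (fun i => b i 0 - (A *m z) i 0) (fun i => (A *m z) i 0 - (A *m y) i 0).
  by move=> i; rewrite inE subr_gt0 lt_neqAle => ->; rewrite Pz.1.
have Pw : polyhedron (z + (- t) *: (y - z)).
  split=> [i|]; last exact: eqs_line Pz.2 Py.2.
  rewrite mulmx_line; have [iJ|iJ] := boolP (i \in J); last first.
    by have := tP i iJ; lra.
  have := tight_y i iJ; move: iJ; rewrite inE /tight => /eqP-> /eqP->.
  by rewrite subrr mulr0 addr0.
apply/eqP; rewrite eq_le valid // andbT.
have := valid _ Pw; rewrite line sz add0r mulNr oppr_ge0 pmulr_rle0 //.
by move: sz; lra.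
Qed.

End Polyhedron.

(* The slack of a valid inequality is supported on the points at which one of
   the inequalities of its face is not tight; [None] stands for an inequality
   that is never tight, needed when the face is empty. *)
Lemma slack_support_cover (R : realType) (E : lmodType R) (P : set E)
    (k r : nat) (Q : set 'cV[R]_k) (I J : Type)
    (c : I -> R) (l : I -> {linear E -> R^o}) (x : J -> E) :
  (forall i y, P y -> 0 <= c i + l i y) -> (forall j, P (x j)) ->
  extended_formulation P Q -> defined_by_ineqs Q r ->
  exists (rows : option 'I_r -> pred I) (cols : option 'I_r -> pred J),
    forall i j, (c i + l i (x j) != 0) = [exists o, rows o i && cols o j].
Proof.
move=> valid Px [_ [pi piQ]] [A [b [q [C [e QE]]]]].
have /choice[w wP] : forall j, exists y, Q y /\ pi y = x j.
  by move=> j; have := Px j; rewrite -piQ => -[y Qy <-]; exists y.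
pose loose (o : option 'I_r) y :=
  if o is Some i then ~~ tight A b i y else true.
have /choice[K KP] : forall i, exists K : {set option 'I_r}, forall y, Q y ->
    (c i + l i (pi y) != 0) = [exists o in K, loose o y].
  move=> i; have validQ y : Q y -> 0 <= c i + l i (pi y).
    by move=> Qy; apply: valid; rewrite -piQ; exists y.
  have [[y0 Qy0 sy0]|none] :=
      pselect (exists2 y0, Q y0 & c i + l i (pi y0) = 0).
    rewrite QE in validQ Qy0.
    have [tights tightsP] :=
      @face_tight _ _ _ _ A b C e (c i) (l i \o pi) y0 validQ Qy0 sy0.
    exists [set Some j | j in tights]%SET => z; rewrite QE => /tightsP /= ->.
    rewrite negb_forall_in.
    apply/exists_inP/exists_inP => [[j jt jz]|[_ /imsetP[j jt ->] jz]].
      by exists (Some j); rewrite ?imset_f.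
    by exists j.
  exists [set None]%SET => z Qz; transitivity true.
    by apply/eqP => sz; apply: none; exists z.
  by apply/esym/exists_inP; exists None; rewrite ?inE.
exists (fun o i => o \in K i), (fun o j => loose o (w j)) => i j.
by have [Qw <-] := wP j; apply: KP.
Qed.

Lemma leq_extension_disjointness (R : realType) (E : lmodType R) (P : set E)
    (T : finType) (r k : nat) (Q : set 'cV[R]_k)
    (c : {set T} -> R) (l : {set T} -> {linear E -> R^o}) (x : {set T} -> E) :
  (forall a y, P y -> 0 <= c a + l a y) -> (forall b, P (x b)) ->
  (forall a b, c a + l a (x b) = (1 - #|a :&: b|%:R) ^+ 2) ->
  extended_formulation P Q -> defined_by_ineqs Q r ->
  (3 ^ #|T| <= r.+1 * 2 ^ #|T|)%N.
Proof.
move=> valid Px slack QE Qr.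
have [rows [cols coverP]] := slack_support_cover valid Px QE Qr.
have := @leq_disjointness_cover T (option 'I_r) rows cols.
rewrite card_option card_ord; apply.
- move=> o a b ao bo; have : [exists o, rows o a && cols o b].
    by apply/existsP; exists o; rewrite ao.
  by rewrite -coverP slack; apply: contraNneq => ->; rewrite subrr expr0n.
- move=> a b ab0; apply/existsP; rewrite -coverP slack ab0 cards0 subr0 expr1n.
  exact: oner_neq0.
Qed.

(** * The coloring polytope *)

Section ConvexHull.
Variables (R : realType) (E : lmodType R).

Lemma subset_conv_hull (S : set E) : S `<=` conv_hull S.
Proof.
move=> y Sy; exists 1%N, (fun=> y), (fun=> 1).
by split=> //; rewrite big_ord1 ?scale1r.
Qed.

Lemma conv_hull_ge0 (S : set E) (c : R) (l : {linear E -> R^o}) :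
  (forall y, S y -> 0 <= c + l y) -> forall y, conv_hull S y -> 0 <= c + l y.
Proof.
move=> valid y [N [p [a [Sp a0 a1 ->]]]].
rewrite -[c]mulr1 -a1 mulr_sumr linear_sum -big_split /= sumr_ge0 // => i _.
by rewrite linearZ mulrC -mulrDr mulr_ge0 // valid.
Qed.

Lemma conv_hull_rangeP (X : finType) (D : X -> E) (y : E) :
  conv_hull (range D) y <-> exists a : X -> R,
    [/\ forall x, 0 <= a x, \sum_x a x = 1 & y = \sum_x a x *: D x].
Proof.
split=> [[N [p [a [pD a0 a1 ->]]]]|[a [a0 a1 ->]]].
  have /choice[x xP] : forall i, exists x, D x = p i.
    by move=> i; have [x _ <-] := pD i; exists x.
  exists (fun z => \sum_(i | x i == z) a i); split=> [z||].
  - exact: sumr_ge0.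
  - by rewrite -a1 [RHS](partition_big x predT).
  - rewrite [LHS](partition_big x predT) //; apply: eq_bigr => z _.
    by rewrite scaler_suml; apply: eq_bigr => i /eqP<-; rewrite xP.
exists #|X|, (D \o enum_val), (a \o enum_val); split=> [i|||] //=.
- by exists (enum_val i).
- by rewrite -(big_enum_val a).
- by rewrite -(big_enum_val (fun x => a x *: D x)).
Qed.

End ConvexHull.

Section ProperColoring.
Variables (V C : finType) (G : sgraph V).

Definition proper_coloring (x : V -> C) : bool :=
  [forall u, forall v, G u v ==> (x u != x v)].

Lemma proper_coloringP (x : V -> C) :
  reflect (forall u v, G u v -> x u != x v) (proper_coloring x).
Proof. exact: (iffP 'forall_'forall_implyP). Qed.

Definition proper_colorings : finType :=
  {x : {ffun V -> C} | proper_coloring x}.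

End ProperColoring.

Definition coloring_mx (R : pzRingType) (d n : nat) (x : {ffun 'I_n -> 'I_d}) :
    'M[R]_(d, n) :=
  \matrix_(c, v) (x v == c)%:R.

Lemma coloring_polytopeE (R : realType) (d n : nat) (G : sgraph 'I_n) :
  solution_polytope R (@coloring d) G =
  conv_hull (range (fun x : proper_colorings 'I_d G => coloring_mx R (val x))).
Proof.
congr conv_hull; apply/seteqP; split=> M.
  move=> [X [cov dis ind] <-].
  have /choice[x xP] : forall v, exists i, v \in X i by [].
  have xE v i : (v \in X i) = (x v == i).
    apply/idP/eqP => [vi|<-//]; apply/eqP/negPn/negP => xvi.
    by have /pred0P/(_ v) := dis _ _ xvi; rewrite /= xP vi.
  have prx : proper_coloring G (finfun x).
    apply/proper_coloringP => u v Guv; rewrite !ffunE -xE; apply/negP => uX.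
    by have := ind _ _ _ uX (xP v); rewrite Guv.
  exists (Sub (finfun x) prx : proper_colorings 'I_d G) => //.
  by apply/matrixP => i v; rewrite !mxE ffunE xE.
move=> [[x /= /proper_coloringP prx] _ <-].
exists [ffun i => [set v | x v == i]%SET].
  split=> [v|i j ij|i u v]; first by exists (x v); rewrite ffunE inE.
  - rewrite -setI_eq0; apply/eqP/setP => v; rewrite !ffunE !inE.
    by apply/negP => /andP[/eqP->]; apply/negP.
  - rewrite !ffunE !inE => /eqP xu /eqP xv.
    by apply/negP => /prx; rewrite xu xv eqxx.
by apply/matrixP => i v; rewrite !mxE ffunE inE.
Qed.

Lemma mxtrace_mul_coloring_mx (R : pzRingType) (d n : nat) (W : 'M[R]_(n, d))
    (x : {ffun 'I_n -> 'I_d}) :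
  \tr (W *m coloring_mx R x) = \sum_v W v (x v).
Proof.
apply: eq_bigr => v _; rewrite mxE (bigD1 (x v)) //= mxE eqxx mulr1.
by rewrite big1 ?addr0 // => c cx; rewrite mxE eq_sym (negbTE cx) mulr0.
Qed.

(** * The gadget graph *)

Definition star_adj (I : finType) : rel (option I) :=
  fun x y => (x == None) (+) (y == None).

Lemma star_adj_sym I : symmetric (@star_adj I).
Proof. by move=> x y; rewrite /star_adj addbC. Qed.

Lemma star_adj_irr I : irreflexive (@star_adj I).
Proof. by move=> x; rewrite /star_adj addbb. Qed.

Definition star (I : finType) : sgraph (option I) :=
  SGraph (@star_adj_sym I) (@star_adj_irr I).

Lemma star_connect (I : finType) (x y : option I) : connect (star I) x y.
Proof.
apply: (@connect_trans _ _ None).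
  by case: x => [x|]; [apply: connect1 | apply: connect0].
by case: y => [y|]; [apply: connect1 | apply: connect0].
Qed.

Lemma star_is_tree (I : finType) : is_tree (star I).
Proof.
split=> [||p]; [by rewrite card_option | exact: star_connect |].
by case: p => [|[x|] [|[y|] [|[z|] [|[w|] p]]]] //;
  rewrite /ucycle /= => /andP[];
  rewrite ?inE /star_adj /= ?andbF ?andbT ?orbT //= ?orbT.
Qed.

(* The vertices in no class, [h v = None], belong to all bags. *)
Lemma treewidth_le_star (V I : finType) (G : sgraph V) (h : V -> option I)
    (k : nat) :
  (forall u v i j, G u v -> h u = Some i -> h v = Some j -> i = j) ->
  (forall o, #|[set v | h v \in [:: None; o]]%SET| <= k.+1)%N ->
  treewidth_le G k.
Proof.
move=> same_class card_bag.
exists (option I), (star I), (fun o => [set v | h v \in [:: None; o]]%SET).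
split=> //; split=> [|v|u v Guv|v i j].
- exact: star_is_tree.
- by exists (h v); rewrite !inE eqxx orbT.
- case hu: (h u) => [i|]; last by exists (h v); rewrite !inE hu eqxx orbT.
  exists (Some i); rewrite !inE hu eqxx orbT /=.
  by case hv: (h v) => [j|//]; rewrite (same_class u v i j) ?eqxx.
- rewrite !inE; case: eqP => [hv _ _|_ /= /eqP<- /eqP<-]; last exact: connect0.
  apply: connect_sub (star_connect i j) => x y xy.
  by apply/connect1/and3P; split; rewrite ?inE ?hv.
Qed.

Section Gadget.
Variable T : finType.

Definition gadget_vertex : finType := (T + T * T * bool)%type.

Lemma big_gadget_vertex (R : nmodType) (F : gadget_vertex -> R) :
  \sum_v F v = \sum_i F (inl i) +
    \sum_i \sum_j (F (inr (i, j, true)) + F (inr (i, j, false))).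
Proof.
rewrite big_sumType pair_bigA /=; congr +%R.
transitivity (\sum_(p : T * T) \sum_(s : bool) F (inr (p, s))).
  by rewrite pair_bigA; apply: eq_bigr => -[].
by apply: eq_bigr => -[i j] _; rewrite big_bool.
Qed.

(* The variable vertices [inl i], and for all i, j a path from [inl i] to
   [inl j] with inner vertices [inr (i, j, true)] and [inr (i, j, false)]. *)
Definition gadget_arc (u v : gadget_vertex) : bool :=
  match u, v with
  | inl k, inr (i, j, s) => k == (if s then i else j)
  | inr (i, j, true), inr (i', j', false) => (i, j) == (i', j')
  | _, _ => false
  end.

Definition gadget_adj : rel 'I_#|gadget_vertex| :=
  fun u v => gadget_arc (enum_val u) (enum_val v)
          || gadget_arc (enum_val v) (enum_val u).

Lemma gadget_adj_sym : symmetric gadget_adj.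
Proof. by move=> u v; rewrite /gadget_adj orbC. Qed.

Lemma gadget_adj_irr : irreflexive gadget_adj.
Proof.
by move=> u; rewrite /gadget_adj orbb; case: (enum_val u) => [|[[? ?] []]].
Qed.

Definition gadget : sgraph 'I_#|gadget_vertex| :=
  SGraph gadget_adj_sym gadget_adj_irr.

Lemma gadget_treewidth : treewidth_le gadget #|T|.+1.
Proof.
pose h (u : 'I_#|gadget_vertex|) :=
  if enum_val u is inr (p, _) then Some p else None.
apply: (@treewidth_le_star _ _ _ h) => [u v p p'|o].
  rewrite /= /gadget_adj /h.
  by case: (enum_val u) (enum_val v) =>
    [//|[[i j] []]] [//|[[i' j'] []]] //= + [<-] [<-];
    rewrite ?orbF => /eqP[-> ->].
pose bag : {set gadget_vertex} :=
  ([set inl i | i : T] :|: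
   (if o is Some p then [set inr (p, true); inr (p, false)] else set0))%SET.
rewrite -(card_imset _ enum_val_inj); apply: (@leq_trans #|bag|).
  apply/subset_leq_card/subsetP => v /imsetP[u + ->]; rewrite !inE /h.
  case: (enum_val u) => [i _|[p s]] /=; first by rewrite imset_f.
  by move=> /eqP<-; rewrite !inE; case: s; rewrite eqxx ?orbT.
rewrite -addn2 (leq_trans (leq_card_setU _ _)) // leq_add ?leq_imset_card //.
by case: o @bag => [p|] bag; rewrite ?cards0 // cards2; case: (_ != _).
Qed.

Lemma proper_gadgetP (C : finType) (x : 'I_#|gadget_vertex| -> C) :
  reflect (forall v w, gadget_arc v w -> x (enum_rank v) != x (enum_rank w))
    (proper_coloring gadget x).
Proof.
apply: (iffP (proper_coloringP _ _)) => [prx v w vw|prx u v].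
  by apply: prx; rewrite /= /gadget_adj !enum_rankK vw.
rewrite /= /gadget_adj => /orP[] /prx; rewrite !enum_valK //.
by rewrite eq_sym.
Qed.

Section Colors.
Variables (R : realType) (d : nat) (c0 c1 c2 : 'I_d).
Hypotheses (c01 : c0 != c1) (c02 : c0 != c2) (c12 : c1 != c2).

Definition gadget_color (b : {set T}) (v : gadget_vertex) : 'I_d :=
  match v with
  | inl i => if i \in b then c1 else c0
  | inr (i, _, true) => if i \in b then c2 else c1
  | inr (i, j, false) => if i \in b then if j \in b then c0 else c1 else c2
  end.

Definition gadget_coloring (b : {set T}) : {ffun 'I_#|gadget_vertex| -> 'I_d} :=
  [ffun u => gadget_color b (enum_val u)].

Lemma proper_gadget_coloring b : proper_coloring gadget (gadget_coloring b).
Proof.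
apply/proper_gadgetP => v w; rewrite !ffunE !enum_rankK.
case: v w => [k|[[i j] []]] [k'|[[i' j'] []]] //=.
- by move=> /eqP->; case: ifP.
- by move=> /eqP->; do 2 case: ifP => //; rewrite 1?eq_sym.
- by move=> /eqP[<- <-]; do 2 case: ifP => //; rewrite 1?eq_sym.
Qed.

Let outer (c : 'I_d) : bool := c \notin [:: c1; c2].

(* If both ends of the path of (i, j) have color c1, then its inner vertices
   cannot use the colors c1 and c2 only. *)
Lemma path_outer_color (ci cy cz cj : 'I_d) :
  ci != cy -> cy != cz -> cj != cz ->
  ((ci == c1) * (cj == c1) <= outer cy + outer cz)%N.
Proof.
rewrite /outer !inE => iy yz jz.
have [ci1|_] := eqVneq ci c1; last by rewrite mul0n.
have [cj1|_] := eqVneq cj c1; last by rewrite muln0.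
rewrite -ci1 eq_sym (negbTE iy) ci1 -cj1 [cz == cj]eq_sym (negbTE jz) /=.
by have [cy2|//] := eqVneq cy c2; rewrite -cy2 eq_sym yz.
Qed.

Definition gadget_weight (a : {set T}) (v : gadget_vertex) (c : 'I_d) : R :=
  match v with
  | inl i => - 2 * ((i \in a) && (c == c1))%:R
  | inr (i, j, _) => ((i \in a) && (j \in a) && outer c)%:R
  end.

Definition gadget_weight_mx (a : {set T}) : 'M[R]_(#|gadget_vertex|, d) :=
  \matrix_(u, c) gadget_weight a (enum_val u) c.

Lemma gadget_slackE a (x : {ffun 'I_#|gadget_vertex| -> 'I_d})
    (g := fun v => x (enum_rank v)) :
  1 + \tr (gadget_weight_mx a *m coloring_mx R x) =
  (1 - \sum_(i in a) (g (inl i) == c1)%:R) ^+ 2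
  + \sum_(i in a) \sum_(j in a)
      ((outer (g (inr (i, j, true))) + outer (g (inr (i, j, false))))%:R
       - ((g (inl i) == c1) * (g (inl j) == c1))%:R).
Proof.
set s := \sum_(i in a) _; pose inner i j s : nat := outer (g (inr (i, j, s))).
have -> : \tr (gadget_weight_mx a *m coloring_mx R x) =
    - 2 * s + \sum_(i in a) \sum_(j in a) (inner i j true + inner i j false)%:R.
  rewrite mxtrace_mul_coloring_mx.
  rewrite (reindex _ (onW_bij _ (@enum_rank_bij gadget_vertex))).
  under eq_bigr do rewrite mxE enum_rankK.
  rewrite big_gadget_vertex /=; congr +%R.
    rewrite mulr_sumr [RHS]big_mkcond; apply: eq_bigr => i _.
    by case: (i \in a); rewrite /= ?mulr0.
  rewrite [RHS]big_mkcond; apply: eq_bigr => i _.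
  case: (i \in a); last by rewrite big1 // => j _; rewrite addr0.
  rewrite [RHS]big_mkcond; apply: eq_bigr => j _.
  by rewrite -natrD; case: (j \in a).
have -> : \sum_(i in a) \sum_(j in a) ((inner i j true + inner i j false)%:R -
      ((g (inl i) == c1) * (g (inl j) == c1))%:R) =
    \sum_(i in a) \sum_(j in a) (inner i j true + inner i j false)%:R
    - s * s :> R.
  rewrite big_distrlr -sumrB; apply: eq_bigr => i _; rewrite -sumrB.
  by apply: eq_bigr => j _; rewrite natrM.
by ring.
Qed.

Lemma gadget_slack_ge0 a (x : {ffun 'I_#|gadget_vertex| -> 'I_d}) :
  proper_coloring gadget x ->
  0 <= 1 + \tr (gadget_weight_mx a *m coloring_mx R x).
Proof.
move=> /proper_gadgetP prx; rewrite gadget_slackE addr_ge0 ?sqr_ge0 //.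
apply: sumr_ge0 => i _; apply: sumr_ge0 => j _; rewrite subr_ge0 ler_nat.
by apply: path_outer_color; apply: prx; rewrite /= ?eqxx.
Qed.

Lemma gadget_slack_coloring a b :
  1 + \tr (gadget_weight_mx a *m coloring_mx R (gadget_coloring b)) =
  (1 - #|a :&: b|%:R) ^+ 2.
Proof.
rewrite gadget_slackE [X in _ + X]big1 ?addr0 => [|i ia]; last first.
  apply: big1 => j ja; rewrite !ffunE !enum_rankK /=; apply/eqP.
  rewrite subr_eq0 /outer !inE; apply/eqP; congr (_%:R).
  by case: (i \in b); case: (j \in b);
    rewrite ?eqxx ?(negbTE c01) ?(negbTE c02) ?orbT //= ?(eq_sym c2) ?c12
      ?(negbTE c12).
congr ((1 - _) ^+ 2); rewrite -sum1_card natr_sum.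
rewrite [LHS]big_mkcond [RHS]big_mkcond; apply: eq_bigr => i _.
rewrite ffunE enum_rankK /= inE.
by case: (i \in a); case: (i \in b); rewrite /= ?eqxx ?(negbTE c01).
Qed.

End Colors.

Lemma gadget_extension_complexity (R : realType) (d k r : nat)
    (Q : set 'cV[R]_k) :
  (3 <= d)%N ->
  extended_formulation (solution_polytope R (@coloring d) gadget) Q ->
  defined_by_ineqs Q r -> (3 ^ #|T| <= r.+1 * 2 ^ #|T|)%N.
Proof.
move=> d3; rewrite coloring_polytopeE.
pose c0 := Ordinal (ltn_trans (isT : 0 < 2)%N d3).
pose c1 := Ordinal (ltn_trans (isT : 1 < 2)%N d3).
pose c2 := Ordinal d3.
pose x b : proper_colorings 'I_d gadget := Sub (gadget_coloring c0 c1 c2 b)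
  (@proper_gadget_coloring d c0 c1 c2 isT isT isT b).
apply: (@leq_extension_disjointness R _ _ T r k Q (fun=> 1)
  (fun a => mxtrace \o mulmx (gadget_weight_mx R c1 c2 a))
  (fun b => coloring_mx R (val (x b)))).
- move=> a; apply: conv_hull_ge0 => _ [z _ <-]; exact/gadget_slack_ge0/(valP z).
- by move=> b; apply: subset_conv_hull; exists (x b).
- by move=> a b; apply: gadget_slack_coloring.
Qed.

End Gadget.

(** * The lower bound *)

Lemma near_monomial_lt_exp (R : realType) (C x : R) (c : nat) : 1 < x ->
  \forall n \near \oo, C * n%:R ^+ c < x ^+ n.
Proof.
move=> x1; have x0 : 0 < x by apply: lt_trans x1.
have fact0 : 0 < c.+1`!%:R :> R by rewrite ltr0n fact_gt0.
have lnx : 0 < ln x ^+ c.+1 by rewrite exprn_gt0 // ln_gt0.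
near=> n; have n_ge : C * c.+1`!%:R / ln x ^+ c.+1 <= n%:R.
  by near: n; apply: nbhs_infty_ger.
rewrite -{1}[x]lnK // -expRM_natl.
apply: lt_le_trans (expR_ge1Dxn c _); last first.
  by rewrite mulr_ge0 ?ln_ge0 // ltW.
rewrite ltr_pwDl // ler_pdivlMr // mulrAC exprMn exprSr -[leRHS]mulrA mulrC.
by rewrite ler_wpM2l ?exprn_ge0 // -ler_pdivrMr.
Unshelve. all: by end_near. Qed.

Lemma near_powR_littleo_le (R : realType) (a x : R) (f : nat -> R^o) :
  1 < a -> 1 < x -> f =o_\oo (fun k : nat => k%:R : R^o) ->
  \forall k \near \oo, a `^ f k <= x ^+ k.
Proof.
move=> a1 x1 fo; have a0 : 0 < a by apply: lt_trans a1.
have x0 : 0 < x by apply: lt_trans x1.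
have eps0 : 0 < ln x / ln a by rewrite divr_gt0 // ln_gt0.
have aeps : a `^ (ln x / ln a) = x.
  by rewrite /powR (gt_eqF a0) divfK ?gt_eqF ?ln_gt0 // lnK.
near=> k.
rewrite -powR_mulrn ?(ltW x0) // -{1}aeps -powRrM ler_powR ?(ltW a1) //.
rewrite (le_trans (ler_norm _)) // -[k%:R in leRHS]ger0_norm //.
by near: k; move/eqoP: fo; apply.
Unshelve. all: by end_near. Qed.

Lemma near_powR_littleo_poly_lt (R : realType) (a x : R) (f : nat -> R^o)
    (p : nat -> R) (h : nat -> nat) (D e : nat) :
  1 < a -> 1 < x -> f =o_\oo (fun k : nat => k%:R : R^o) -> poly_bounded p ->
  (forall k, (h k <= D * k ^ e)%N) ->
  \forall k \near \oo, a `^ f k * p (h k) < x ^+ k.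
Proof.
move=> a1 x1 fo [C [c pC]] hD; pose y := Num.sqrt x.
have y1 : 1 < y by rewrite -sqrtr1 ltr_sqrt // (lt_trans _ x1).
near=> k; have -> : x ^+ k = y ^+ k * y ^+ k.
  by rewrite -exprMn -expr2 sqr_sqrtr // (le_trans _ (ltW x1)).
have yk0 : 0 < y ^+ k by rewrite exprn_gt0 // (lt_trans _ y1).
have p_lt : p (h k) < y ^+ k.
  apply: (@le_lt_trans _ _ ((C * D ^ c)%:R * k%:R ^+ (e * c))).
    apply: le_trans (pC _) _; rewrite natrM -mulrA ler_wpM2l //.
    rewrite natrX exprM -exprMn.
    by rewrite -[k%:R ^+ e]natrX -natrM lerXn2r ?nnegrE ?ler_nat.
  by near: k; apply: near_monomial_lt_exp.
apply: (@le_lt_trans _ _ (y ^+ k * Num.max 0 (p (h k)))).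
  apply: (@le_trans _ _ (a `^ f k * Num.max 0 (p (h k)))).
    by rewrite ler_wpM2l ?powR_ge0 // le_max lexx orbT.
  rewrite ler_wpM2r ?le_max ?lexx //.
  by near: k; apply: near_powR_littleo_le.
by rewrite ltr_pM2l // gt_max yk0.
Unshelve. all: by end_near. Qed.

Lemma coloring_no_ext_formulation (R : realType) (d : nat) (f : nat -> R^o)
    (p : nat -> R) :
  (3 <= d)%N -> f =o_\oo (fun k : nat => k%:R : R^o) -> poly_bounded p ->
  no_ext_formulation (@coloring d) (fun k n => d%:R `^ f k * p n).
Proof.
move=> d3 fo p_poly.
pose N k := #|gadget_vertex 'I_k.-1|.
have N_le k : (N k <= 3 * k ^ 2)%N.
  by rewrite /N card_sum !card_prod card_bool !card_ord; nia.
have d1 : 1 < d%:R :> R by rewrite ltr1n; lia.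
have x1 : 1 < 4 / 3 :> R by lra.
near \oo => k.
have k0 : (0 < k)%N by near: k; apply: nbhs_infty_gt.
(* Of the factors of (3/2)^k = (4/3)^k (9/8)^k, the first one exceeds the bound
   and the second one absorbs the constants. *)
have bound_lt : d%:R `^ f k * p (N k) < (4 / 3) ^+ k.
  by near: k; apply: near_powR_littleo_poly_lt fo p_poly N_le.
have gap : 3 < (9 / 8) ^+ k :> R.
  near: k; have := @near_monomial_lt_exp R 3 (9 / 8) 0.
  by under eq_near do rewrite expr0 mulr1; apply; lra.
exists k, (N k), (gadget 'I_k.-1); split=> [|m Q QE r Qr].
  by have := gadget_treewidth 'I_k.-1; rewrite card_ord prednK.
apply: (lt_trans bound_lt).
have := gadget_extension_complexity d3 QE Qr; rewrite card_ord.
rewrite -(ler_nat R) natrM !natrX -ler_pdivrMr ?exprn_gt0 // -expr_div_n.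
have -> : (3 / 2) ^+ k.-1 = 2 / 3 * ((4 / 3) ^+ k * (9 / 8) ^+ k) :> R.
  have -> : 3 / 2 = 4 / 3 * (9 / 8) :> R by field.
  by rewrite -exprMn -[in RHS](prednK k0) exprS; field.
have : 1 <= (4 / 3) ^+ k :> R by rewrite exprn_ege1 // ltW.
rewrite -natr1; move: gap; move: ((4 / 3 : R) ^+ k) ((9 / 8 : R) ^+ k) => u v.
by nra.
Unshelve. all: by end_near. Qed.

(** * Elimination orders from tree decompositions *)

Definition avoiding (T : finType) (t : rel T) (x : T) : rel T :=
  [rel a b | [&& t a b, a != x & b != x]].

Lemma avoiding_sym (T : finType) (t : rel T) x :
  symmetric t -> symmetric (avoiding t x).
Proof.
by move=> sym_t a b; rewrite /avoiding /= sym_t [(a != x) && _]andbC.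
Qed.

Lemma path_avoidingE (T : finType) (t : rel T) (x y : T) (p : seq T) :
  y != x -> path (avoiding t x) y p = path t y p && (x \notin y :: p).
Proof.
elim: p y => [|z p IHp] y yx /=; first by rewrite inE eq_sym yx.
rewrite {1}/avoiding /= yx inE [x == y]eq_sym (negbTE yx) /=.
have [->|zx] := eqVneq z x; first by rewrite inE eqxx !andbF.
by rewrite andbT IHp // andbA.
Qed.

(* Two neighbours connected off x would close a cycle through x. *)
Lemma tree_neighbor_unique (T : finType) (t : sgraph T) (x y y' : T) :
  is_tree t -> t x y -> t x y' -> connect (avoiding t x) y y' -> y = y'.
Proof.
move=> [_ _ acyc] xy xy' /connectP[p0 pth0 lst0].
move: lst0; case: (shortenP pth0) => p pth up _ lst; apply/eqP.
case: p pth up lst => [|z p] pth up lst; first by rewrite lst.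
have yx : y != x by apply: contraTneq xy => ->; rewrite (adj_irr t).
move: pth; rewrite path_avoidingE // => /andP[tp xp].
have := acyc [:: x, y, z & p].
rewrite /ucycle cons_uniq xp up andbT /= rcons_path.
by move: tp lst => /= /andP[-> ->] <-; rewrite xy (adj_sym t) xy' => /(_ isT).
Qed.

Lemma connect_depth (T : finType) (e : rel T) (r : T) :
  (forall x, connect e x r) ->
  exists dep : T -> nat,
    forall x, x != r -> exists2 y, e x y & (dep y < dep x)%N.
Proof.
move=> conn.
pose reach x n := [exists p : n.-tuple T, path e x p && (last x p == r)].
have reachI x p : path e x p -> last x p = r -> reach x (size p).
  by move=> pth lst; apply/existsP; exists (in_tuple p); rewrite pth lst eqxx.
have ex x : exists n, reach x n.
  by have /connectP[p pth lst] := conn x; exists (size p); apply: reachI.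
exists (fun x => ex_minn (ex x)) => x xr.
case: (ex_minnP (ex x)) => n /existsP[[p /= /eqP <-] /andP[pth /eqP lst]] _.
case: p pth lst => [_ xE|y p /= /andP[xy pth] lst].
  by rewrite -xE eqxx in xr.
by exists y => //; case: ex_minnP => m _; rewrite ltnS; apply; apply: reachI.
Qed.

Section RootedTree.
Variables (T : finType) (t : sgraph T) (r : T) (dep : T -> nat).
Hypothesis tree_t : is_tree t.
Hypothesis descend : forall x, x != r -> exists2 y, t x y & (dep y < dep x)%N.

Lemma root_depth_lt x : x != r -> (dep r < dep x)%N.
Proof.
elim: (dep x).+1 {-2}x (ltnSn (dep x)) => // n IHn {}x xn xr.
have [y _ yx] := descend xr; have [<-//|yr] := eqVneq y r.
by rewrite (ltn_trans (IHn y _ yr)) // (leq_trans yx).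
Qed.

Lemma connect_avoiding_root i j : j != i -> (dep j <= dep i)%N ->
  connect (avoiding t i) j r.
Proof.
elim: (dep j).+1 {-2}j (ltnSn (dep j)) => // n IHn {}j jn ji le_ji.
have [->|jr] := eqVneq j r; first exact: connect0.
have [y jy lt_yj] := descend jr.
have yi : y != i by apply: contraTneq lt_yj => ->; rewrite -leqNgt.
apply: (@connect_trans _ _ y).
  by apply: connect1; rewrite /avoiding /= jy ji yi.
apply: IHn => //; first exact: leq_trans lt_yj jn.
exact: ltnW (leq_trans lt_yj le_ji).
Qed.

Definition parent (i : T) : T := odflt i [pick y | t i y && (dep y < dep i)%N].

Lemma parentP i : i != r -> t i (parent i) && (dep (parent i) < dep i)%N.
Proof.
move=> ir; rewrite /parent; case: pickP => [//|none].
by have [y iy yi] := descend ir; have := none y; rewrite iy yi.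
Qed.

Lemma parent_in_subtree (S : {set T}) i j :
  connect [rel x y | [&& t x y, x \in S & y \in S]] i j ->
  j != i -> (dep j <= dep i)%N -> parent i \in S /\ (dep (parent i) < dep i)%N.
Proof.
move=> /connectP[p0 pth0 lst0] ji le_ji.
have ir : i != r.
  by apply: contraTneq le_ji => ir; rewrite -ltnNge ir root_depth_lt -?ir.
have /andP[i_par lt_par] := parentP ir; split=> //.
have par_i : parent i != i by apply: contraTneq lt_par => ->; rewrite ltnn.
move: lst0; case: (shortenP pth0) => -[|y p] /= pth + _ lst.
  by rewrite lst eqxx in ji.
move: pth => /andP[/and3P[iy _ yS] pth] /andP[ip _].
suff <- : y = parent i by [].
apply: (tree_neighbor_unique tree_t iy i_par); apply: (@connect_trans _ _ j).
  apply/connectP; exists p => //; rewrite path_avoidingE ?ip ?andbT.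
    by apply: sub_path pth => a b /and3P[].
  by move: ip; rewrite inE negb_or eq_sym => /andP[].
apply: connect_trans (connect_avoiding_root ji le_ji) _.
rewrite (sym_connect_sym (avoiding_sym i (adj_sym t))).
exact: connect_avoiding_root par_i (ltnW lt_par).
Qed.

End RootedTree.

(* The highest nodes of two subtrees sharing a node are on the path from that
   node to the root, so the deeper of them lies in both subtrees. *)
Lemma bag_top (V T : finType) (G : sgraph V) (t : sgraph T) (B : T -> {set V}) :
  tree_decomposition G t B ->
  exists (dep : T -> nat) (top : V -> T),
    (forall v, v \in B (top v)) /\
    forall u v i, u \in B i -> v \in B i ->
      (dep (top u) <= dep (top v))%N -> u \in B (top v).
Proof.
move=> [tree vert edge sub].
have [/card_gt0P[r _] conn _] := tree.
have [dep descend] := connect_depth (fun x => conn x r).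
have /choice[top topP] : forall v, exists i, v \in B i /\
    forall j, v \in B j -> (dep i <= dep j)%N.
  move=> v; have [i0 vi0] := vert v.
  have [i vi imin] := @arg_minnP _ i0 (fun i => v \in B i) dep vi0.
  by exists i.
exists dep, top; split=> [v|u v i]; first by have [] := topP v.
have up w j : w \in B j -> j != top w ->
    w \in B (parent t dep j) /\ (dep (parent t dep j) < dep j)%N.
  move=> wj jtop; have [wtop top_min] := topP w.
  have [|||] := @parent_in_subtree _ _ _ _ tree descend
      [set x | w \in B x]%SET j (top w).
  - apply: connect_sub (sub w j (top w) wj wtop) => x y xy.
    by apply: connect1; rewrite /= !inE.
  - by rewrite eq_sym.
  - exact: top_min.
  - by rewrite inE.
elim: (dep i).+1 {-2}i (ltnSn (dep i)) => // n IHn {}i lt_in ui vi le_uv.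
have [<-//|itop] := eqVneq i (top v).
have [vpar lt_par] := up v i vi itop.
have utop : i != top u.
  apply: contraTneq lt_par => iu; rewrite -leqNgt {1}iu (leq_trans le_uv) //.
  by have [_] := topP v; apply.
have [upar _] := up u i ui utop.
by apply: (IHn (parent t dep i)) => //; exact: leq_trans lt_par lt_in.
Qed.

(* Eliminating the vertices by decreasing [rank], the set [bag v] consists of v
   and its higher neighbours in the chordal completion. *)
Record elimination_order (V : finType) (G : sgraph V) (rank : V -> nat)
    (bag : V -> {set V}) : Prop := EliminationOrder {
  rank_inj : injective rank;
  bag_refl : forall v, v \in bag v;
  bag_rank : forall u v, u \in bag v -> (rank u <= rank v)%N;
  bag_edge : forall u v, G u v -> (rank u <= rank v)%N -> u \in bag v;
  bag_clique : forall u v w, u \in bag v -> w \in bag v ->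
    (rank u <= rank w)%N -> u \in bag w }.

Lemma treewidth_elimination_order (V : finType) (G : sgraph V) (k : nat) :
  treewidth_le G k ->
  exists (rank : V -> nat) (bag : V -> {set V}),
    elimination_order G rank bag /\ forall v, (#|bag v| <= k.+1)%N.
Proof.
move=> [T [t [B [td width]]]]; have [dep [top [vtop topP]]] := bag_top td.
pose rank v := (dep (top v) * #|V| + enum_rank v)%N.
have ltV (v : V) : (enum_rank v < #|V|)%N by [].
have rank_dep u v : (rank u <= rank v)%N -> (dep (top u) <= dep (top v))%N.
  have rankE w : (rank w %/ #|V|)%N = dep (top w).
    by rewrite divnMDl ?divn_small ?addn0 // (leq_trans _ (ltV w)).
  by move=> /(leq_div2r #|V|); rewrite !rankE.
exists rank, (fun v => [set u in B (top v) | (rank u <= rank v)%N]%SET); split.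
  split=> [u v|v|u v|u v Guv le_uv|u v w]; rewrite ?inE.
  - move=> /(congr1 (modn^~ #|V|)); rewrite /rank !modnMDl !modn_small //.
    by move=> /ord_inj/enum_rank_inj.
  - by rewrite vtop leqnn.
  - by move=> /andP[].
  - have [i /andP[ui vi]] := td_edge td Guv.
    by rewrite le_uv (topP _ _ _ ui vi (rank_dep _ _ le_uv)).
  - move=> /andP[uv _] /andP[wv _] le_uw.
    by rewrite le_uw (topP _ _ _ uv wv (rank_dep _ _ le_uw)).
move=> v; apply: leq_trans (width (top v)); apply: subset_leq_card.
by apply/subsetP => u; rewrite inE => /andP[].
Qed.

(** * Nonnegative combinations *)

(* Subtract the largest possible multiple of some [D x] supported in the support
   of y: one more coordinate of y vanishes. *)
Lemma greedy_nonneg_combination (R : realFieldType) (X J : finType)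
    (D : X -> J -> R) (K : set (J -> R)) :
  (forall x j, 0 <= D x j) -> (forall x, exists j, D x j != 0) ->
  (forall y x t, K y -> K (fun j => y j - t * D x j)) ->
  (forall y, K y -> (forall j, 0 <= y j) -> (exists j, y j != 0) ->
     exists x, forall j, D x j != 0 -> y j != 0) ->
  forall y, K y -> (forall j, 0 <= y j) ->
  exists2 a : X -> R, forall x, 0 <= a x & forall j, y j = \sum_x a x * D x j.
Proof.
move=> D_ge0 D_neq0 K_sub K_supp y.
elim: {y}_.+1 {-2}y (ltnSn #|[set j | y j != 0]%SET|) => // n IHn y lt_n Ky y0.
have [/existsP yN0|/existsPn y_eq0] := boolP [exists j, y j != 0]; last first.
  exists (fun=> 0) => // j; rewrite big1 => [|x _]; last by rewrite mul0r.
  by apply/eqP/negPn/y_eq0.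
have [x xy] := K_supp y Ky y0 yN0; have [j0 xj0] := D_neq0 x.
have [j xj jmin] :=
  @arg_minP _ _ _ j0 (fun j => D x j != 0) (fun j => y j / D x j) xj0.
set t := y j / D x j in jmin; have t0 : 0 <= t by rewrite divr_ge0.
have [||a a0 yE] := IHn (fun j => y j - t * D x j) _ (K_sub y x t Ky).
- rewrite -ltnS (leq_trans _ lt_n) // ltnS; apply: proper_card.
  apply/properP; split.
    apply/subsetP => i; rewrite !inE; apply: contraNneq => yi0.
    have [->|/xy] := eqVneq (D x i) 0; first by rewrite yi0 mulr0 subrr.
    by rewrite yi0 eqxx.
  by exists j; rewrite !inE ?xy // /t divfK // subrr eqxx.
- move=> i; rewrite subr_ge0.
  have [->|xi] := eqVneq (D x i) 0; first by rewrite mulr0.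
  by rewrite -ler_pdivlMr ?jmin // lt_neqAle eq_sym xi D_ge0.
exists (fun z => a z + t * (z == x)%:R) => [z|i].
  by rewrite addr_ge0 // mulr_ge0.
under eq_bigr do rewrite mulrDl.
rewrite big_split /= -yE (bigD1 x) //= eqxx mulr1.
by rewrite big1 ?addr0 ?subrK // => z /negbTE->; rewrite mulr0 mul0r.
Qed.

Lemma affine_hull_eqs (R : fieldType) (X : finType) (m : nat)
    (D : X -> 'cV[R]_m) :
  exists (q : nat) (C : 'M[R]_(q, m)) (e : 'cV[R]_q), forall y,
    C *m y = e <-> exists2 c : X -> R, \sum_x c x = 1 & y = \sum_x c x *: D x.
Proof.
(* y is in the affine hull iff (y, 1) is in the linear span of the (D x, 1). *)
pose points : 'M[R]_(#|X|, m) := \matrix_k (D (enum_val k))^T.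
pose W : 'M[R]_(#|X|, m + 1) := row_mx points (const_mx 1).
have WE (c : X -> R) : (\row_k c (enum_val k)) *m W =
    row_mx (\sum_x c x *: D x)^T (\sum_x c x)%:M.
  rewrite mul_mx_row mulmx_sum_row linear_sum.
  rewrite (big_enum_val (fun x => (c x *: D x)^T)) /=.
  congr row_mx; first by apply: eq_bigr => k _; rewrite mxE rowK linearZ.
  apply/rowP => j; rewrite [j]ord1 !mxE eqxx mulr1n (big_enum_val c).
  by apply: eq_bigr => k _; rewrite !mxE mulr1.
exists (m + 1)%N, (usubmx (cokermx W))^T, (- (dsubmx (cokermx W))^T) => y.
have -> : (usubmx (cokermx W))^T *m y = - (dsubmx (cokermx W))^T <->
    (row_mx y^T 1%:M <= W)%MS.
  rewrite submxE -[cokermx W in X in _ <-> X]vsubmxK mul_row_col mul1mx.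
  rewrite -(inj_eq trmx_inj) linearD /= trmx_mul trmxK trmx0 addr_eq0.
  by split=> [->|/eqP].
split=> [/submxP[u uW]|[c c1 ->]].
  have uE : u = \row_k u 0 (enum_rank (enum_val k)).
    by apply/rowP => k; rewrite mxE enum_valK.
  move: uW; rewrite uE (WE (fun x => u 0 (enum_rank x))) => /eq_row_mx[yE c1].
  exists (fun x => u 0 (enum_rank x)); last exact: trmx_inj.
  by move/matrixP/(_ 0 0): c1; rewrite !mxE eqxx.
by rewrite -c1 -WE submxMl.
Qed.

Lemma nonneg_affine_hull_extension (R : realType) (E : lmodType R) (X : finType)
    (m : nat) (D : X -> 'cV[R]_m) (pi : {linear 'cV[R]_m -> E}) :
  (forall x k, 0 <= D x k 0) ->
  (forall c : X -> R, \sum_x c x = 1 ->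
     (forall k, 0 <= (\sum_x c x *: D x) k 0) ->
     exists a : X -> R, [/\ forall x, 0 <= a x, \sum_x a x = 1 &
       \sum_x c x *: D x = \sum_x a x *: D x]) ->
  exists2 Q : set 'cV[R]_m,
    extended_formulation (conv_hull (range (pi \o D))) Q & defined_by_ineqs Q m.
Proof.
move=> D_ge0 convex_comb; have [q [C [e Ce]]] := affine_hull_eqs D.
pose Q := polyhedron (- 1%:M) 0 C e.
have QE y : Q y <-> exists a : X -> R,
    [/\ forall x, 0 <= a x, \sum_x a x = 1 & y = \sum_x a x *: D x].
  split=> [[y0 /Ce[c c1 yE]]|[a [a0 a1 yE]]].
    rewrite yE in y0 *; apply: convex_comb => // k.
    by have := y0 k; rewrite mulNmx mul1mx !mxE oppr_le0.
  split=> [k|]; last by apply/Ce; exists a.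
  rewrite mulNmx mul1mx !mxE oppr_le0 yE summxE sumr_ge0 // => x _.
  by rewrite mxE mulr_ge0.
have Qineqs : defined_by_ineqs Q m by exists (- 1%:M), 0, q, C, e.
exists Q => //; split; [split; first by exists m |].
  exists (\sum_x \sum_k D x k 0) => y /QE[a [a0 a1 ->]] k.
  rewrite summxE (le_trans (ler_norm_sum _ _ _)) // ler_sum // => x _.
  rewrite mxE ger0_norm ?mulr_ge0 // (le_trans (_ : _ <= D x k 0)) //.
    by rewrite ler_piMl // -a1 (bigD1 x) //= lerDl sumr_ge0.
  by rewrite (bigD1 k) //= lerDl sumr_ge0.
exists pi; apply/seteqP; split=> M.
  move=> [y /QE[a [a0 a1 ->]] <-]; apply/conv_hull_rangeP; exists a; split=> //.
  by rewrite linear_sum; apply: eq_bigr => x _; rewrite linearZ.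
move=> /conv_hull_rangeP[a [a0 a1 ->]]; exists (\sum_x a x *: D x).
  by apply/QE; exists a.
by rewrite linear_sum; apply: eq_bigr => x _; rewrite linearZ.
Qed.

(** * Local marginals *)

Section Agree.
Variables (V C : finType).
Implicit Types (x z : {ffun V -> C}) (S : {set V}).

Definition agree S x z : bool := [forall u in S, x u == z u].

Lemma agreeP S x z : reflect {in S, x =1 z} (agree S x z).
Proof. exact: eqfun_inP. Qed.

Definition patch S x z : {ffun V -> C} :=
  [ffun u => if u \in S then x u else z u].

Lemma agree_patch S x z : agree S (patch S x z) x.
Proof. by apply/agreeP => u uS; rewrite ffunE uS. Qed.

Lemma agreeC_patch S x z : agree (~: S) (patch S x z) z.
Proof. by apply/agreeP => u; rewrite inE ffunE => /negbTE->. Qed.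

End Agree.

Section Marginals.
Variables (R : realFieldType) (V C X : finType) (ev : X -> {ffun V -> C}).
Implicit Types (z s : {ffun V -> C}) (S : {set V}) (c : X -> R).

Definition marginal c S z : R := \sum_(x | agree S (ev x) z) c x.

Lemma marginalE c S z : marginal c S z = \sum_x c x * (agree S (ev x) z)%:R.
Proof.
rewrite /marginal big_mkcond; apply: eq_bigr => x _.
by case: ifP; rewrite ?mulr1 ?mulr0.
Qed.

Lemma marginal_sub_dirac c t x S z :
  marginal (fun x' => c x' - t * (x' == x)%:R) S z =
  marginal c S z - t * (agree S (ev x) z)%:R.
Proof.
rewrite {1}/marginal sumrB -mulr_sumr; congr (_ - _ * _).
rewrite big_mkcond (bigD1 x) //= eqxx big1 ?addr0; first by case: ifP.
by move=> x' /negbTE->; case: ifP.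
Qed.

Lemma eq_marginal c S z z' :
  {in S, z =1 z'} -> marginal c S z = marginal c S z'.
Proof.
move=> zz'; apply: eq_bigl => x.
by apply/agreeP/agreeP => xz u uS; rewrite xz // zz'.
Qed.

Lemma marginal_set0 c z : marginal c set0 z = \sum_x c x.
Proof. by apply: eq_bigl => x; apply/agreeP => u; rewrite inE. Qed.

Lemma marginal_subset c S S' z : S \subset S' ->
  marginal c S z =
  \sum_(s | agree S s z && agree (~: S') s z) marginal c S' s.
Proof.
move=> /subsetP SS'; rewrite /marginal.
rewrite (partition_big (fun x => patch S' (ev x) z)
  (fun s => agree S s z && agree (~: S') s z)) /= => [|x /agreeP xz].
  apply: eq_bigr => s /andP[/agreeP sz /agreeP sz']; apply: eq_bigl => x.
  apply/andP/agreeP => [[_ /eqP<-] u uS'|xs]; first by rewrite ffunE uS'.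
  split; first by apply/agreeP => u uS; rewrite -sz // xs // SS'.
  apply/eqP/ffunP => u; rewrite ffunE; case: ifP => [/xs//|uS'].
  by rewrite sz' // inE uS'.
rewrite agreeC_patch andbT; apply/agreeP => u uS.
by rewrite ffunE SS' // xz.
Qed.

Lemma marginal_gt0_subset c S S' z : S \subset S' ->
  (forall s, 0 <= marginal c S' s) -> 0 < marginal c S' z -> 0 < marginal c S z.
Proof.
move=> SS' ge0 gt0; rewrite (marginal_subset _ _ SS') (bigD1 z) /=.
  by rewrite ltr_wpDr ?sumr_ge0.
by apply/andP; split; apply/agreeP.
Qed.

Lemma marginal_gt0_superset c S S' z : S \subset S' -> 0 < marginal c S z ->
  exists2 s, agree S s z & 0 < marginal c S' s.
Proof.
move=> SS' gt0; have [s /andP[sz s0]|none] :=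
    pickP (fun s => agree S s z && (0 < marginal c S' s)); first by exists s.
move: gt0; rewrite (marginal_subset _ _ SS') ltNge sumr_le0 // => s /andP[sz _].
by have := none s; rewrite sz /= ltNge => /negbFE.
Qed.

Lemma marginal_gt0_ex c S z : 0 < marginal c S z -> exists x, agree S (ev x) z.
Proof.
move=> gt0; have [x xz|none] := pickP (fun x => agree S (ev x) z).
  by exists x.
by move: gt0; rewrite /marginal big_pred0 ?ltxx.
Qed.

Section Elimination.
Variables (G : sgraph V) (rank : V -> nat) (bag : V -> {set V}).
Hypothesis order : elimination_order G rank bag.

Lemma bag_predecessor v :
  bag v :\ v = set0 \/
  exists2 w, (rank w < rank v)%N & bag v :\ v \subset bag w.
Proof.
have [->|/set0Pn[w0 w0v]] := eqVneq (bag v :\ v) set0; [by left | right].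
have [w + w_max] := @arg_maxnP _ w0 (fun w => w \in bag v :\ v) rank w0v.
rewrite !inE => /andP[wv wA]; exists w.
  rewrite ltn_neqAle (bag_rank order wA) andbT.
  by apply: contra wv => /eqP/(rank_inj order)->.
apply/subsetP => u uv; apply: (bag_clique order) wA _; last exact: w_max.
by move: uv; rewrite inE => /andP[].
Qed.

Lemma extend_positive_marginal c v z :
  (forall w s, 0 <= marginal c (bag w) s) -> 0 < \sum_x c x ->
  (forall w, (rank w < rank v)%N -> 0 < marginal c (bag w) z) ->
  exists2 s, agree (bag v :\ v) s z & 0 < marginal c (bag v) s.
Proof.
move=> ge0 total_gt0 z_gt0; apply: marginal_gt0_superset; first exact: subD1set.
have [->|[w wv vw]] := bag_predecessor v; first by rewrite marginal_set0.
exact: marginal_gt0_subset vw (ge0 w) (z_gt0 w wv).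
Qed.

Lemma greedy_positive_marginals c :
  (forall v z, 0 <= marginal c (bag v) z) -> 0 < \sum_x c x ->
  exists z, forall v, 0 < marginal c (bag v) z.
Proof.
move=> ge0 total_gt0; have [x0 _|X0] := pickP (@predT X); last first.
  by move: total_gt0; rewrite big_pred0 ?ltxx.
suff [z zP] : exists z, forall v, (rank v < (\max_v rank v).+1)%N ->
    0 < marginal c (bag v) z.
  by exists z => v; apply: zP; rewrite ltnS leq_bigmax.
elim: (_.+1) => [|j [z zP]]; first by exists (ev x0).
have [v /eqP vj|none] := pickP (fun v => rank v == j); last first.
  exists z => v; rewrite ltnS leq_eqVlt => /orP[/eqP vj|]; last exact: zP.
  by have := none v; rewrite vj eqxx.
rewrite -vj in zP *.
have [s /agreeP sz s_gt0] := extend_positive_marginal ge0 total_gt0 zP.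
exists [ffun u => if u == v then s v else z u] => w.
rewrite ltnS leq_eqVlt => /orP[/eqP/(rank_inj order)->|wv].
  rewrite (eq_marginal _ (z' := s)) // => u uv; rewrite ffunE.
  by have [->//|uNv] := eqVneq u v; rewrite sz // !inE uNv.
rewrite (eq_marginal _ (z' := z)) ?zP // => u uw; rewrite ffunE.
case: eqP => // uv; move: (bag_rank order uw).
by rewrite uv leqNgt wv.
Qed.

Hypothesis ev_local : forall z,
  (forall v, exists x, agree (bag v) (ev x) z) -> exists x, ev x = z.

(* The empty bag is added because its marginal is the total mass. *)
Let obag (o : option V) : {set V} := if o is Some v then bag v else set0.

Lemma greedy_positive_point c :
  (forall o z, 0 <= marginal c (obag o) z) ->
  (exists o z, marginal c (obag o) z != 0) ->
  exists x, forall o, 0 < marginal c (obag o) (ev x).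
Proof.
move=> ge0 [i [s sN0]]; have total_gt0 : 0 < \sum_x c x.
  rewrite -(marginal_set0 _ s).
  apply: marginal_gt0_subset (sub0set _) (ge0 i) _.
  by rewrite lt_neqAle eq_sym sN0 ge0.
have [z zP] := greedy_positive_marginals (fun v => ge0 (Some v)) total_gt0.
have [x xz] := ev_local (fun v => marginal_gt0_ex (zP v)).
by exists x; case=> [v|]; rewrite xz //= marginal_set0.
Qed.

Lemma nonneg_marginals_measure c :
  (forall v z, 0 <= marginal c (bag v) z) -> 0 <= \sum_x c x ->
  exists a : X -> R, [/\ forall x, 0 <= a x, \sum_x a x = \sum_x c x &
    forall v z, marginal a (bag v) z = marginal c (bag v) z].
Proof.
move=> ge0 total_ge0.
pose K := [set y : option V * {ffun V -> C} -> R |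
  exists c', forall p, y p = marginal c' (obag p.1) p.2].
pose D x (p : option V * {ffun V -> C}) : R := (agree (obag p.1) (ev x) p.2)%:R.
have D_ge0 x p : 0 <= D x p by [].
have D_neq0 x : exists p, D x p != 0.
  by exists (None, ev x); rewrite /D (introT (agreeP _ _ _)) ?oner_eq0.
have K_sub y x t : K y -> K (fun p => y p - t * D x p).
  move=> [c' yE]; exists (fun x' => c' x' - t * (x' == x)%:R) => p.
  by rewrite yE marginal_sub_dirac.
have K_supp y : K y -> (forall p, 0 <= y p) -> (exists p, y p != 0) ->
    exists x, forall p, D x p != 0 -> y p != 0.
  move=> [c' yE] y_ge0 [p yN0]; have [||x xP] := @greedy_positive_point c'.
  - by move=> o z; rewrite -(yE (o, z)).
  - by exists p.1, p.2; rewrite -yE.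
  exists x => q; rewrite pnatr_eq0 eqb0 negbK => /agreeP xq.
  by rewrite yE -(eq_marginal _ xq) gt_eqF.
have [|p|a a0 aE] := greedy_nonneg_combination D_ge0 D_neq0 K_sub K_supp
  (y := fun p => marginal c (obag p.1) p.2).
- by exists c.
- by case: p => [[v|] z] //=; rewrite marginal_set0.
exists a; split=> // [|v z].
  have [x0 _|X0] := pickP (@predT X); last by rewrite !big_pred0.
  by have := aE (None, ev x0); rewrite /D -marginalE !marginal_set0.
by have := aE (Some v, z); rewrite /D -marginalE.
Qed.

End Elimination.
End Marginals.

(** * The extended formulation *)

(* A coloring of a bag is encoded by its extension to all vertices by c0. *)
Definition bag_coloring (V C : finType) (c0 : C) (bag : V -> {set V}) :
    finType :=
  {p : V * {ffun V -> C} | agree (~: bag p.1) p.2 [ffun=> c0]}.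

Lemma card_bag_coloring (V C : finType) (c0 : C) (bag : V -> {set V})
    (k : nat) :
  (forall v, (#|bag v| <= k)%N) ->
  (#|bag_coloring c0 bag| <= #|V| * #|C| ^ k)%N.
Proof.
move=> bag_k; rewrite card_sig -sum1_card.
rewrite -(pair_big_dep predT (fun v s => agree (~: bag v) s [ffun=> c0])
  (fun _ _ => 1%N)) /=.
rewrite -sum_nat_const; apply: leq_sum => v _; rewrite sum1_card.
have C0 : (0 < #|C|)%N by apply/card_gt0P; exists c0.
apply: leq_trans (leq_pexp2l C0 (bag_k v)).
rewrite -(card_pffun_on c0 (bag v) C); apply: subset_leq_card.
apply/subsetP => s; rewrite unfold_in => /agreeP s0.
apply/pffun_onP; split=> //; apply/supportP => u ub.
by rewrite s0 ?ffunE // inE.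
Qed.

Section TreewidthFormulation.
Variables (R : realType) (d n : nat) (c0 : 'I_d) (G : sgraph 'I_n).
Variables (rank : 'I_n -> nat) (bag : 'I_n -> {set 'I_n}).
Hypothesis order : elimination_order G rank bag.

Let I : finType := bag_coloring c0 bag.
Let X : finType := proper_colorings 'I_d G.
Let node (k : 'I_#|I|) : 'I_n := (val (enum_val k : I)).1.
Let local (k : 'I_#|I|) : {ffun 'I_n -> 'I_d} := (val (enum_val k : I)).2.

Let index_of (v : 'I_n) (z : {ffun 'I_n -> 'I_d}) : 'I_#|I| :=
  enum_rank (Sub (v, patch (bag v) z [ffun=> c0]) (agreeC_patch _ _ _) : I).

Let node_index v z : node (index_of v z) = v.
Proof. by rewrite /node enum_rankK. Qed.

Let local_index v z : local (index_of v z) = patch (bag v) z [ffun=> c0].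
Proof. by rewrite /local enum_rankK. Qed.

Let agree_indexP k v z :
  reflect (k = index_of v z) ((node k == v) && agree (bag v) z (local k)).
Proof.
apply: (iffP andP) => [[/eqP kv /agreeP zk]|->].
  apply: enum_val_inj; rewrite enum_rankK; apply: val_inj => /=.
  rewrite [LHS]surjective_pairing -/(node k) -/(local k) kv; congr pair.
  apply/ffunP => u; rewrite ffunE; case: ifP => [/zk //|uv].
  have /agreeP -> // := valP (enum_val k : I).
  by rewrite inE -/(node k) kv uv.
rewrite node_index local_index eqxx; split=> //.
by apply/agreeP => u uv; rewrite ffunE uv.
Qed.

Definition local_indicator (x : X) : 'cV[R]_#|I| :=
  \col_k (agree (bag (node k)) (val x) (local k))%:R.

Definition color_reading : {linear 'cV[R]_#|I| -> 'M[R]_(d, n)} :=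
  mulmx (\matrix_(i, k) (local k (node k) == i)%:R)
  \o mulmxr (\matrix_(k, v) (node k == v)%:R) \o @diag_mx R _ \o trmx.

Lemma color_reading_local_indicator x :
  color_reading (local_indicator x) = coloring_mx R (val x).
Proof.
apply/matrixP => i v; rewrite /color_reading /= mul_diag_mx !mxE.
rewrite (bigD1 (index_of v (val x))) //= big1 => [|k /eqP kNv].
  have /andP[_ xk] := introT (agree_indexP _ v (val x)) erefl.
  rewrite addr0 !mxE node_index eqxx mulr1 xk mulr1 local_index ffunE.
  by rewrite (bag_refl order).
rewrite !mxE; case: (node k =P v) => [kv|_]; last by rewrite !mulr0.
case xk: (agree _ _ _); last by rewrite mul0r mulr0.
by case: kNv; apply/agree_indexP; rewrite -kv eqxx.
Qed.

Lemma sum_local_indicatorE (c : X -> R) k :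
  (\sum_x c x *: local_indicator x) k 0 =
  marginal val c (bag (node k)) (local k).
Proof. by rewrite summxE marginalE; apply: eq_bigr => x _; rewrite !mxE. Qed.

Lemma proper_coloring_local (z : {ffun 'I_n -> 'I_d}) :
  (forall v, exists x : X, agree (bag v) (val x) z) -> exists x : X, val x = z.
Proof.
move=> z_local; suff prz : proper_coloring G z by exists (Sub z prz).
apply/proper_coloringP.
suff edge u v : G u v -> (rank u <= rank v)%N -> z u != z v.
  move=> u v Guv.
  have [/edge|/ltnW/edge] := leqP (rank u) (rank v); first exact.
  by rewrite eq_sym (adj_sym G); apply.
move=> Guv le_uv; have [x /agreeP xz] := z_local v.
rewrite -!xz ?(bag_refl order) ?(bag_edge order) //.
exact: (proper_coloringP _ _ (valP x)).
Qed.

Lemma coloring_formulation :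
  exists2 Q : set 'cV[R]_#|bag_coloring c0 bag|,
    extended_formulation (solution_polytope R (@coloring d) G) Q &
    defined_by_ineqs Q #|bag_coloring c0 bag|.
Proof.
have readingE :
    color_reading \o local_indicator = fun x => coloring_mx R (val x).
  by apply/funext => x; apply: color_reading_local_indicator.
rewrite coloring_polytopeE -readingE.
apply: nonneg_affine_hull_extension => [x k|c c1 c_ge0]; first by rewrite mxE.
have marginals_ge0 v z : 0 <= marginal val c (bag v) z.
  have := c_ge0 (index_of v z).
  rewrite sum_local_indicatorE node_index local_index.
  by rewrite (eq_marginal _ _ (z' := z)) //; apply/agreeP/agree_patch.
have [|a [a0 a1 aE]] :=
  nonneg_marginals_measure order proper_coloring_local marginals_ge0.
  by rewrite c1.
exists a; split; rewrite ?a1 //; apply/colP => k.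
by rewrite !sum_local_indicatorE aE.
Qed.

End TreewidthFormulation.

Lemma coloring_ext_complexity (R : realType) (d k n : nat) (G : sgraph 'I_n) :
  (0 < d)%N -> treewidth_le G k ->
  ext_complexity_le (solution_polytope R (@coloring d) G) (d ^ k.+1 * n)%:R.
Proof.
move=> d_gt0 /treewidth_elimination_order[rank [bag [order card_bag]]].
have [Q QE Qineqs] := coloring_formulation R (Ordinal d_gt0) order.
have card_le := card_bag_coloring (Ordinal d_gt0) card_bag.
rewrite !card_ord in card_le.
by eexists _, Q, _; split; [exact: QE | exact: Qineqs | rewrite ler_nat mulnC].
Qed.

Theorem theorem6p8 (R : realType) (d : nat) (d_gt0 : (0 < d)%N) :
  (exists p : nat -> R, poly_bounded p /\
     has_ext_complexity (@coloring d) (fun k n => d%:R ^+ k * p n))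
  /\
  ((3 <= d)%N -> ETH R ->
     forall (f : nat -> R^o) (p : nat -> R),
       f =o_\oo (fun k : nat => k%:R : R^o) -> poly_bounded p ->
       no_ext_formulation (@coloring d) (fun k n => d%:R `^ f k * p n)).
Proof.
split=> [|d3 _ f p]; last exact: coloring_no_ext_formulation.
exists (fun n => d%:R * n%:R); split=> [|k n G twG]; first by exists d, 1%N.
rewrite mulrA -exprSr -natrX -natrM; exact: coloring_ext_complexity.
Qed.
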